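(* Let $a,b,c\in\mathbb{R}$ with $a\neq 0$, put $\Delta=b^2-4ac$, $p=-\frac{b}{2a}$, $q=-\frac{\Delta}{4a}$, and assume $q>0$. Then $ax^2+bx+c=a(x-p)^2+q$. Let $x\in\mathbb{R}$ with $x\neq p$ and $ax^2+bx+c\geq 0$, let $y=\sqrt{ax^2+bx+c}$, and define $t\in\mathbb{R}$ by the relation $$y=\sqrt{q}+(x-p)\,t .$$ Then $t^2\neq a$ and $$x=p+\frac{2t\sqrt{q}}{a-t^2},\qquad y=\frac{a+t^2}{a-t^2}\,\sqrt{q}.$$ Moreover, regarding $x$ as the function of $t$ given by this formula, $$\frac{dx}{dt}=\frac{2(a+t^2)\sqrt{q}}{(a-t^2)^2}.$$ Consequently, for every rational function $R$ of two variables, under this substitution the integrand $R\left(x,\sqrt{ax^2+bx+c}\right)dx$ becomes $$R\left(p+\frac{2t\sqrt{q}}{a-t^2},\ \frac{a+t^2}{a-t^2}\sqrt{q}\right)\frac{2(a+t^2)\sqrt{q}}{(a-t^2)^2}\,dt,$$ whose coefficient of $dt$ is a rational function of $t$ (wherever the expressions are defined).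
   Context: Here $\sqrt{\cdot}$ denotes the nonnegative real square root. A rational function of two variables is a quotient of two polynomials in $x$ and $y$ with real coefficients. The relation $y=\sqrt{q}+(x-p)t$ is called the fourth Euler substitution; geometrically, $t$ is the slope of the line joining $(x,y)$ to the point $(p,\sqrt{q})$ of the conic $y^2=ax^2+bx+c$. *)

(* Defs.v *)
From mathcomp Require Import all_boot all_order all_algebra.
From mathcomp Require Import all_classical all_reals all_analysis.
Import Order.TTheory GRing.Theory Num.Theory.
Import numFieldNormedType.Exports.
Set Implicit Arguments.
Unset Strict Implicit.
Unset Printing Implicit Defensive.
Local Open Scope classical_set_scope.
Local Open Scope ring_scope.

(* A rational function of two variables is given by polynomials P and Q with
   Q != 0; its value is meaningful only where Q.[x, y] != 0.  In u.[x, y] the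
   outer variable of u : {poly {poly R}} is sent to x, the inner one to y. *)
Definition ratfun2 (R : realType) (P Q : {poly {poly R}}) (x y : R) : R :=
  P.[x, y] / Q.[x, y].

(* f coincides on A with a quotient of polynomials having no pole on A. *)
Definition rational_on (R : realType) (A : set R) (f : R -> R) : Prop :=
  exists N D : {poly R}, D != 0 /\
    forall t, A t -> D.[t] != 0 /\ f t = N.[t] / D.[t].

(* Under x = phi t, the form f(x) dx becomes (pullback_coef phi f t) dt. *)
Definition pullback_coef (R : realType) (phi f : R -> R) (t : R) : R :=
  f (phi t) * derive1 phi t.

(* Main.v *)
Require Import Defs.
From mathcomp Require Import all_boot all_order all_algebra.
From mathcomp Require Import all_classical all_reals all_analysis.
From mathcomp Require Import ring.
Import Order.TTheory GRing.Theory Num.Theory.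
Import numFieldNormedType.Exports.
Local Open Scope classical_set_scope.
Local Open Scope ring_scope.

(** Writing [s] for the square root of [q], the conic is [y ^ 2 - s ^ 2 =
    a (x - p) ^ 2], so the line of slope [t] through its point [(p, s)] meets
    it in at most one further point: substituting [y = s + (x - p) t] and
    cancelling [x - p] leaves the linear equation
    [(x - p) (a - t ^ 2) = 2 t s] ([conic_chord]).  If [t ^ 2] were [a], this
    equation would give [t s = 0], hence [a = 0]; so it can be solved for [x],
    and [y] follows from the equation of the line ([chord_ordinate]).

    The last claim holds because the functions that are rational without pole
    on a set form a ring, in which a nowhere vanishing function is invertible;
    polynomials in the rational functions [x(t)] and [y(t)] are therefore
    rational ([rational_on_horner2]), and so are their quotients. *)

(** * Functions that are rational on a set *)

Section RationalOn.
Variable R : realType.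
Implicit Types (A : set R) (f g : R -> R).

(** A denominator without zero on [A] is a nonzero polynomial as soon as [A]
    has a point; on the empty set the fraction [0 / 1] serves. *)
Lemma rational_on_intro A f (N D : {poly R}) :
  (forall t, A t -> D.[t] != 0 /\ f t = N.[t] / D.[t]) -> rational_on A f.
Proof.
move=> fE; have [A0|/set0P[t0 At0]] := eqVneq A set0.
  by exists 0, 1; split; [exact: oner_neq0 | rewrite A0].
exists N, D; split=> //; apply: contraTneq (proj1 (fE t0 At0)) => ->.
by rewrite horner0 eqxx.
Qed.

Lemma rational_on_cst A (k : R) : rational_on A (fun=> k).
Proof.
apply: (@rational_on_intro _ _ k%:P 1) => t _.
by rewrite !hornerC oner_neq0 divr1.
Qed.

Lemma rational_on_id A : rational_on A (fun t => t).
Proof.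
apply: (@rational_on_intro _ _ 'X 1) => t _.
by rewrite hornerX hornerC oner_neq0 divr1.
Qed.

Lemma rational_onD A f g :
  rational_on A f -> rational_on A g -> rational_on A (fun t => f t + g t).
Proof.
move=> [N [D [_ fE]]] [M [E [_ gE]]].
apply: (@rational_on_intro _ _ (N * E + M * D) (D * E)) => t At.
have [D0 ->] := fE t At; have [E0 ->] := gE t At.
by rewrite hornerD !hornerM mulf_neq0 // addf_div.
Qed.

Lemma rational_onM A f g :
  rational_on A f -> rational_on A g -> rational_on A (fun t => f t * g t).
Proof.
move=> [N [D [_ fE]]] [M [E [_ gE]]].
apply: (@rational_on_intro _ _ (N * M) (D * E)) => t At.
have [D0 ->] := fE t At; have [E0 ->] := gE t At.
by rewrite !hornerM mulf_neq0 // mulf_div.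
Qed.

Lemma rational_onV A f :
  (forall t, A t -> f t != 0) -> rational_on A f ->
  rational_on A (fun t => (f t)^-1).
Proof.
move=> f0 [N [D [_ fE]]]; apply: (@rational_on_intro _ _ D N) => t At.
have [_ ftE] := fE t At; have := f0 t At.
by rewrite ftE mulf_eq0 negb_or invf_div => /andP[].
Qed.

Lemma rational_on_horner2 A f g (P : {poly {poly R}}) :
  rational_on A f -> rational_on A g ->
  rational_on A (fun t => P.[f t, g t]).
Proof.
move=> rf rg.
(* The coefficients of P are themselves polynomials, to be evaluated at g. *)
have rC (N : {poly R}) : rational_on A (fun t => N.[g t]).
  elim/poly_ind: N => [|N k IHN].
    by under eq_fun do rewrite horner0; exact: rational_on_cst.
  under eq_fun do rewrite hornerMXaddC.
  by apply: rational_onD; [exact: rational_onM | exact: rational_on_cst].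
elim/poly_ind: P => [|P C IHP].
  by under eq_fun do rewrite !horner0; exact: rational_on_cst.
under eq_fun do rewrite hornerMXaddC hornerD hornerM hornerC.
by apply: rational_onD => //; exact: rational_onM.
Qed.

End RationalOn.

(** * The chord of slope [t] through the vertex *)

Section Chord.
Variable F : fieldType.
Implicit Types a s t u : F.

(** Here [u] is the offset [x - p]; subtracting [s ^ 2] from both sides of the
    equation of the conic leaves a multiple of [u] on each side. *)
Lemma conic_chord a s t u :
  u != 0 -> (s + u * t) ^+ 2 = a * u ^+ 2 + s ^+ 2 ->
  u * (a - t ^+ 2) = 2 * t * s.
Proof.
move=> u0 e; apply: (mulfI u0); apply/eqP; rewrite -subr_eq0.
have -> : u * (u * (a - t ^+ 2)) - u * (2 * t * s) =
    a * u ^+ 2 + s ^+ 2 - (s + u * t) ^+ 2 by ring.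
by rewrite e subrr.
Qed.

(** The abscissa that solves the linear equation of [conic_chord], put into
    the equation of the line. *)
Lemma chord_ordinate a s t :
  t ^+ 2 != a ->
  s + 2 * t * s / (a - t ^+ 2) * t = (a + t ^+ 2) / (a - t ^+ 2) * s.
Proof. by move=> ta; field; rewrite subr_eq0 eq_sym. Qed.

End Chord.

Lemma is_derive_chord_abscissa (R : realType) (a s p t : R) :
  t ^+ 2 != a ->
  is_derive t (1 : R) (fun t => p + 2 * t * s / (a - t ^+ 2))
    (2 * (a + t ^+ 2) * s / (a - t ^+ 2) ^+ 2).
Proof.
move=> ta; have d0 : a - t ^+ 2 != 0 by rewrite subr_eq0 eq_sym.
apply: is_derive_eq.
by rewrite /GRing.scale /=; field.
Qed.

Theorem mainTheorem1 (R : realType) (a b c : R) (ha : a != 0) :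
  let Delta := b ^+ 2 - 4 * a * c in
  let p := - (b / (2 * a)) in
  let q := - (Delta / (4 * a)) in
  let quad := fun x : R => a * x ^+ 2 + b * x + c in
  let X := fun t : R => p + 2 * t * Num.sqrt q / (a - t ^+ 2) in
  let Y := fun t : R => (a + t ^+ 2) / (a - t ^+ 2) * Num.sqrt q in
  let dX := fun t : R => 2 * (a + t ^+ 2) * Num.sqrt q / (a - t ^+ 2) ^+ 2 in
  0 < q ->
  [/\ forall x : R, quad x = a * (x - p) ^+ 2 + q,
      forall x t : R, x != p -> 0 <= quad x ->
        Num.sqrt (quad x) = Num.sqrt q + (x - p) * t ->
        [/\ t ^+ 2 != a, x = X t & Num.sqrt (quad x) = Y t],
      forall t : R, t ^+ 2 != a -> is_derive t (1 : R) X (dX t)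
    & forall P Q : {poly {poly R}}, Q != 0 ->
        (forall t : R, t ^+ 2 != a ->
           Num.sqrt (quad (X t)) = Num.sqrt q + (X t - p) * t ->
           Q.[X t, Num.sqrt (quad (X t))] != 0 ->
           pullback_coef X (fun x => ratfun2 P Q x (Num.sqrt (quad x))) t =
             ratfun2 P Q (X t) (Y t) * dX t) /\
        rational_on [set t | t ^+ 2 != a /\ Q.[X t, Y t] != 0]
          (fun t => ratfun2 P Q (X t) (Y t) * dX t)].
Proof.
move=> Delta p q quad X Y dX q0; set s := Num.sqrt q.
have s0 : s != 0 by rewrite gt_eqF // sqrtr_gt0.
have sq : s ^+ 2 = q by rewrite sqr_sqrtr // ltW.
have quadE x : quad x = a * (x - p) ^+ 2 + q.
  by rewrite /quad /p /q /Delta; field; rewrite ha.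
have d0 t : t ^+ 2 != a -> a - t ^+ 2 != 0 by rewrite subr_eq0 eq_sym.
have lineE t : t ^+ 2 != a -> s + (X t - p) * t = Y t.
  by move=> ta; rewrite /X /Y -/s -chord_ordinate // [p + _]addrC addrK.
have dXE t : t ^+ 2 != a -> is_derive t (1 : R) X (dX t).
  exact: is_derive_chord_abscissa.
split=> //.
- move=> x t xp quad0 yE.
  have u0 : x - p != 0 by rewrite subr_eq0.
  have chord : (x - p) * (a - t ^+ 2) = 2 * t * s.
    by apply: conic_chord => //; rewrite sq -quadE -yE sqr_sqrtr.
  have ta : t ^+ 2 != a.
    apply/negP => /eqP ta; move: chord; rewrite ta subrr mulr0.
    move/esym/eqP; rewrite !mulf_eq0 pnatr_eq0 (negbTE s0) orbF /= => /eqP t0.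
    by move: ha; rewrite -ta t0 expr0n eqxx.
  have xX : x = X t.
    by rewrite /X -/s -chord mulfK ?d0 // addrC subrK.
  by split=> //; rewrite yE -lineE // -xX.
- move=> P Q _; split=> [t ta yE _|].
    (* The hypothesis yE fixes the sign of the square root, which in general
       only equals the absolute value of Y t. *)
    rewrite /pullback_coef derive1E (@derive_val _ _ _ _ _ _ _ (dXE t ta)).
    by rewrite yE lineE.
  set A := [set t | _].
  (* Instead of exhibiting a common denominator, build X, Y and dX up from
     their subexpressions. *)
  have rt : rational_on A (fun t => t) by exact: rational_on_id.
  have rt2 : rational_on A (fun t => t ^+ 2) by exact: rational_onM.
  have rd : rational_on A (fun t => (a - t ^+ 2)^-1).
    apply: rational_onV => [t [/d0 //]|].
    under eq_fun do rewrite -mulN1r.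
    apply: rational_onD; first exact: rational_on_cst.
    by apply: rational_onM => //; exact: rational_on_cst.
  have rs : rational_on A (fun=> s) by exact: rational_on_cst.
  have r2 : rational_on A (fun=> 2) by exact: rational_on_cst.
  have rat2 : rational_on A (fun t => a + t ^+ 2).
    by apply: rational_onD => //; exact: rational_on_cst.
  have rX : rational_on A X.
    apply: rational_onD; first exact: rational_on_cst.
    by do 3 ![apply: rational_onM => //].
  have rY : rational_on A Y by do 2 ![apply: rational_onM => //].
  have rdX : rational_on A dX.
    rewrite /dX; under eq_fun do rewrite -exprVn.
    by apply: rational_onM; apply: rational_onM => //; exact: rational_onM.
  apply: rational_onM => //; apply: rational_onM.
    exact: rational_on_horner2.
  by apply: rational_onV => [t []//|]; exact: rational_on_horner2.
Qed.
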